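(* Consider the alternately shifted grid process with $\lambda=1/2$. For every real $\alpha>0$ and every integer $M>0$ there exists an integer $p=p(M,\alpha)$ such that, if the initial data $(u_j^0)_{j\in\mathbf{Z}}$ belongs to $H_\alpha^M$, then for all $n\ge p$ the solution $(u_j^n)_j$ at time $n$ belongs to $H_\alpha^2$ or to $H_\alpha^1$, and the solution is $2$-periodic from time $p$ on: $u_j^{n+2}=u_j^n$ for all $n\ge p$ and all indices $j$ of the grid at time $n$ ($j\in\mathbf{Z}$ if $n$ is even, $j\in\mathbf{Z}+\frac12$ if $n$ is odd).
   Context: Alternately shifted grid process with $\lambda=1/2$. For $a\in\mathbf{R}$ let $\mathcal{C}_a=(a-1/2,a+1/2)$. The data at even times $n$ is a sequence $(u_j^n)_{j\in\mathbf{Z}}$; at odd times $n$ it is a sequence $(u_j^n)_{j\in\mathbf{Z}+1/2}$; $u_j^n$ is attached to the cell $\mathcal{C}_j$. Given the data at time $n$, the reconstruction $u_{rec}^n$ is defined on each cell $\mathcal{C}_j$ of the grid at time $n$ as follows. If $u_{j+1}^n\neq u_{j-1}^n$ and $d_j=\frac{u_j^n-u_{j-1}^n}{u_{j+1}^n-u_{j-1}^n}\in(0,1)$, then $u_{rec}^n(x)=u_{j-1}^n$ for $j-\frac12<x<j+\frac12-d_j$ and $u_{rec}^n(x)=u_{j+1}^n$ for $j+\frac12-d_j<x<j+\frac12$. Otherwise $u_{rec}^n=u_j^n$ on $\mathcal{C}_j$. Then $u_k^{n+1}=\int_{\mathcal{C}_k}u_{rec}^n(x)\,dx$ for all $k\in\mathbf{Z}+\frac12$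 if $n$ is even, and for all $k\in\mathbf{Z}$ if $n$ is odd. For $\alpha\ge0$ and an integer $M\ge1$, $H_\alpha^M$ is the set of real sequences $(v_j)_j$ such that there is an index $j_0$ with: $v_j=0$ for $j\le j_0$; $v_j=1$ for $j\ge j_0+M$; $v_{j_0+1}-v_{j_0}>0$ and $v_{j_0+M}-v_{j_0+M-1}>0$; and $v_{j+1}-v_j>\alpha$ for all $j\in\{j_0+1,\dots,j_0+M-2\}$. Here indices $j,j_0$ range over $\mathbf{Z}$ for data at even times and over $\mathbf{Z}+\frac12$ for data at odd times. *)

(* Defs.v *)
From Stdlib Require Export Reals ZArith Lra Lia.
From Coquelicot Require Export Coquelicot.

Open Scope R_scope.

(** Data at time [n] are stored as a sequence [v : Z -> R].  The integer [i]
    stands for the grid index [node n i], which is [i] when [n] is even and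
    [i + 1/2] when [n] is odd; shifting a grid index by 1 is shifting [i] by 1. *)
Definition offset (n : nat) : R := if Nat.even n then 0 else 1 / 2.

Definition node (n : nat) (i : Z) : R := IZR i + offset n.

(** The [i] such that [node n i - 1/2 <= x < node n i + 1/2].  The choice made
    at cell boundaries, and at the jump in [rec_cell], does not affect
    integrals. *)
Definition cell_index (n : nat) (x : R) : Z := Int_part (x - offset n + 1 / 2).

Definition jump_ratio (v : Z -> R) (i : Z) : R :=
  (v i - v (i - 1)%Z) / (v (i + 1)%Z - v (i - 1)%Z).

Definition rec_cell (n : nat) (v : Z -> R) (i : Z) (x : R) : R :=
  let d := jump_ratio v i in
  match Req_EM_T (v (i + 1)%Z) (v (i - 1)%Z), Rlt_dec 0 d, Rlt_dec d 1 with
  | right _, left _, left _ =>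
      if Rlt_dec x (node n i + 1 / 2 - d) then v (i - 1)%Z else v (i + 1)%Z
  | _, _, _ => v i
  end.

Definition u_rec (n : nat) (v : Z -> R) (x : R) : R :=
  rec_cell n v (cell_index n x) x.

Definition step (n : nat) (v : Z -> R) (k : Z) : R :=
  RInt (u_rec n v) (node (S n) k - 1 / 2) (node (S n) k + 1 / 2).

Fixpoint solution (u0 : Z -> R) (n : nat) : Z -> R :=
  match n with
  | O => u0
  | S m => step m (solution u0 m)
  end.

(** The defining conditions are invariant under a translation of the indices,
    so one definition on [Z -> R] serves both grids. *)
Definition H_class (alpha : R) (M : Z) (v : Z -> R) : Prop :=
  exists j0 : Z,
    (forall j : Z, (j <= j0)%Z -> v j = 0) /\
    (forall j : Z, (j0 + M <= j)%Z -> v j = 1) /\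
    v (j0 + 1)%Z - v j0 > 0 /\
    v (j0 + M)%Z - v (j0 + M - 1)%Z > 0 /\
    (forall j : Z, (j0 + 1 <= j <= j0 + M - 2)%Z -> v (j + 1)%Z - v j > alpha).

(* Main.v *)
Require Import Defs.

(** For monotone data with jumps [a_j] and [m_j = min(a_j, a_(j+1))], one step
    turns the jumps into [(a_j + a_(j+1) + 2 m_j - m_(j-1) - m_(j+1)) / 2], which
    is at least [m_j]. The left end of the front moves outwards by half a cell
    exactly when the first jump exceeds the second one, and inwards otherwise; it
    never moves outwards twice in a row, and the same holds on the right. Hence
    the width cannot grow over two steps, and it drops as soon as one end moves
    inwards twice in a row. If the left end alternates, its first jump [x]
    decreases over each period by at least [3/4 min(y, z)], with [y], [z] the next
    two jumps. This exceeds [3/4 alpha], except when only three jumps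
    [x > y >= z] remain, and then two steps leave two jumps. As the first jump is
    at most 1, the width eventually drops to 2, and fronts of width at most 2 are
    2-periodic. *)

(** * Jumps and the one-step map on monotone data *)

Definition jump (v : Z -> R) (j : Z) : R := v j - v (j - 1)%Z.

(** On monotone data the reconstruction of cell [j] has integral
    [(v j - m_j) / 2] over the left half and [(v j + m_j) / 2] over the right half. *)
Definition evolve (v : Z -> R) (j : Z) : R :=
  (v j + v (j + 1)%Z + Rmin (jump v j) (jump v (j + 1)%Z)
   - Rmin (jump v (j + 1)%Z) (jump v (j + 2)%Z)) / 2.

Lemma jump_eq (v : Z -> R) (i j : Z) : (j = i + 1)%Z -> jump v j = v j - v i.
Proof. intros ->. unfold jump. now replace (i + 1 - 1)%Z with i by lia. Qed.

Lemma evolve_eq (v : Z -> R) (i j k : Z) : (j = i + 1)%Z -> (k = i + 2)%Z ->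
  evolve v i = (v i + v j + Rmin (jump v i) (jump v j) - Rmin (jump v j) (jump v k)) / 2.
Proof. intros -> ->. reflexivity. Qed.

Lemma jump_evolve (v : Z -> R) (h i j k : Z) :
  (h = i - 1)%Z -> (j = i + 1)%Z -> (k = i + 2)%Z ->
  jump (evolve v) i = (jump v i + jump v j + 2 * Rmin (jump v i) (jump v j)
               - Rmin (jump v h) (jump v i) - Rmin (jump v j) (jump v k)) / 2.
Proof.
  intros -> Hj Hk. rewrite (jump_eq (evolve v) (i - 1) i) by lia.
  rewrite (evolve_eq v i j k), (evolve_eq v (i - 1) i j) by lia.
  rewrite (jump_eq v i j), (jump_eq v (i - 1) i) by lia. field.
Qed.

(** * Integrals of the reconstruction over half cells *)

Lemma is_RInt_step (f : R -> R) (a b c A B : R) : a <= c <= b ->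
  (forall x, a < x < b -> f x = if Rlt_dec x c then A else B) ->
  is_RInt f a b ((c - a) * A + (b - c) * B).
Proof.
  intros Hc Hf.
  apply (is_RInt_Chasles f a c b ((c - a) * A) ((b - c) * B)).
  - apply is_RInt_ext with (fun _ => A).
    + intros x. rewrite Rmin_left, Rmax_right by lra. intros Hx.
      rewrite Hf by lra. now destruct (Rlt_dec x c); [|lra].
    + apply (is_RInt_const a c A).
  - apply is_RInt_ext with (fun _ => B).
    + intros x. rewrite Rmin_left, Rmax_right by lra. intros Hx.
      rewrite Hf by lra. now destruct (Rlt_dec x c); [lra|].
    + apply (is_RInt_const c b B).
Qed.

Lemma u_rec_cell (n : nat) (v : Z -> R) (i : Z) (x : R) :
  node n i - 1 / 2 < x < node n i + 1 / 2 -> u_rec n v x = rec_cell n v i x.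
Proof.
  unfold u_rec, node. intros Hx. f_equal. unfold cell_index. symmetry.
  apply Int_part_spec. lra.
Qed.

(** With nonnegative jumps [a], [b] at the two sides of the cell, [d = a / (a + b)]. It is
    undefined, or not strictly between 0 and 1, only if [a] or [b] vanishes, and then their minimum
    is 0. *)
Lemma rec_cell_shape (n : nat) (v : Z -> R) (i : Z) :
  0 <= jump v i -> 0 <= jump v (i + 1)%Z ->
  (forall x, rec_cell n v i x = v i) /\ Rmin (jump v i) (jump v (i + 1)%Z) = 0 \/
  exists d, 0 < d < 1 /\ d * (jump v i + jump v (i + 1)%Z) = jump v i /\
    forall x, rec_cell n v i x =
      if Rlt_dec x (node n i + 1 / 2 - d) then v (i - 1)%Z else v (i + 1)%Z.
Proof.
  intros H1 H2. pose proof (jump_eq v i (i + 1) eq_refl) as E2.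
  pose proof (jump_eq v (i - 1) i ltac:(lia)) as E1. unfold rec_cell.
  destruct (Req_EM_T _ _) as [e|ne].
  - left. split; [easy|]. rewrite Rmin_left; lra.
  - assert (Hd : jump_ratio v i * (jump v i + jump v (i + 1)%Z) = jump v i).
    { rewrite E1, E2. unfold jump_ratio. field. lra. }
    destruct (Rlt_dec 0 _); [destruct (Rlt_dec _ 1)|].
    + right. exists (jump_ratio v i). auto.
    + left. split; [easy|]. rewrite Rmin_right; nra.
    + left. split; [easy|]. rewrite Rmin_left; nra.
Qed.

(** The discontinuity lies at distance [d] from the right end, hence in this half when [d <= 1/2],
    that is when the left jump is at most the right one. Otherwise the half carries the constant
    [v (i + 1)], treated as a step with an empty first piece. *)
Lemma rec_cell_right_half (n : nat) (v : Z -> R) (i : Z) :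
  0 <= jump v i -> 0 <= jump v (i + 1)%Z ->
  is_RInt (rec_cell n v i) (node n i) (node n i + 1 / 2)
    ((v i + Rmin (jump v i) (jump v (i + 1)%Z)) / 2).
Proof.
  intros H1 H2. pose proof (jump_eq v i (i + 1) eq_refl) as E2.
  pose proof (jump_eq v (i - 1) i ltac:(lia)) as E1.
  destruct (rec_cell_shape n v i H1 H2) as [[Hc ->]|[d [Hd01 [Hd Hc]]]];
    set (x := node n i) in *.
  - replace ((v i + 0) / 2) with ((x - x) * v i + (x + 1 / 2 - x) * v i) by field.
    apply is_RInt_step; [lra|]. intros y _. rewrite Hc. now destruct (Rlt_dec _ _).
  - destruct (Rle_dec d (1 / 2)).
    + rewrite Rmin_left by nra.
      replace ((v i + jump v i) / 2) with
        ((x + 1 / 2 - d - x) * v (i - 1)%Z + (x + 1 / 2 - (x + 1 / 2 - d)) * v (i + 1)%Z)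
        by nra.
      apply is_RInt_step; [lra|]. intros y _. apply Hc.
    + rewrite Rmin_right by nra.
      replace ((v i + jump v (i + 1)%Z) / 2) with
        ((x - x) * v (i - 1)%Z + (x + 1 / 2 - x) * v (i + 1)%Z) by lra.
      apply is_RInt_step; [lra|]. intros y Hy. rewrite Hc.
      destruct (Rlt_dec y _); destruct (Rlt_dec y x); try reflexivity; lra.
Qed.

Lemma rec_cell_left_half (n : nat) (v : Z -> R) (i : Z) :
  0 <= jump v i -> 0 <= jump v (i + 1)%Z ->
  is_RInt (rec_cell n v i) (node n i - 1 / 2) (node n i)
    ((v i - Rmin (jump v i) (jump v (i + 1)%Z)) / 2).
Proof.
  intros H1 H2. pose proof (jump_eq v i (i + 1) eq_refl) as E2.
  pose proof (jump_eq v (i - 1) i ltac:(lia)) as E1.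
  destruct (rec_cell_shape n v i H1 H2) as [[Hc ->]|[d [Hd01 [Hd Hc]]]];
    set (x := node n i) in *.
  - replace ((v i - 0) / 2) with ((x - (x - 1 / 2)) * v i + (x - x) * v i) by field.
    apply is_RInt_step; [lra|]. intros y _. rewrite Hc. now destruct (Rlt_dec _ _).
  - destruct (Rle_dec d (1 / 2)).
    + rewrite Rmin_left by nra.
      replace ((v i - jump v i) / 2) with
        ((x - (x - 1 / 2)) * v (i - 1)%Z + (x - x) * v (i + 1)%Z) by lra.
      apply is_RInt_step; [lra|]. intros y Hy. rewrite Hc.
      destruct (Rlt_dec y _); destruct (Rlt_dec y x); try reflexivity; lra.
    + rewrite Rmin_right by nra.
      replace ((v i - jump v (i + 1)%Z) / 2) with
        ((x + 1 / 2 - d - (x - 1 / 2)) * v (i - 1)%Z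
         + (x - (x + 1 / 2 - d)) * v (i + 1)%Z) by nra.
      apply is_RInt_step; [lra|]. intros y _. apply Hc.
Qed.

(** The cell [k] of the new grid is the right half of the old cell [i] followed
    by the left half of the old cell [i + 1]. *)
Lemma step_evolve (n : nat) (v : Z -> R) (k : Z) : (forall j, 0 <= jump v j) ->
  step n v k = evolve v (k - if Nat.even n then 0 else 1)%Z.
Proof.
  intros Hv. set (i := (k - _)%Z). unfold step. apply is_RInt_unique.
  assert (E1 : node (S n) k - 1 / 2 = node n i).
  { unfold node, offset, i. rewrite Nat.even_succ, <- Nat.negb_even, minus_IZR.
    destruct (Nat.even n); cbn; lra. }
  assert (E2 : node n (i + 1) = node n i + 1).
  { unfold node. rewrite plus_IZR. lra. }
  replace (node (S n) k + 1 / 2) with (node n (i + 1)) by lra. rewrite E1.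
  rewrite (evolve_eq v i (i + 1) (i + 1 + 1)) by lia.
  replace ((v i + v (i + 1)%Z + Rmin (jump v i) (jump v (i + 1)%Z)
      - Rmin (jump v (i + 1)%Z) (jump v (i + 1 + 1)%Z)) / 2)
    with ((v i + Rmin (jump v i) (jump v (i + 1)%Z)) / 2 +
      (v (i + 1)%Z - Rmin (jump v (i + 1)%Z) (jump v (i + 1 + 1)%Z)) / 2) by field.
  apply (is_RInt_Chasles (u_rec n v) (node n i) (node n i + 1 / 2) (node n (i + 1))
    ((v i + Rmin (jump v i) (jump v (i + 1)%Z)) / 2)
    ((v (i + 1)%Z - Rmin (jump v (i + 1)%Z) (jump v (i + 1 + 1)%Z)) / 2)).
  - eapply is_RInt_ext; [|apply rec_cell_right_half; apply Hv].
    intros x. rewrite Rmin_left, Rmax_right by lra. intros Hx.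
    symmetry. apply u_rec_cell. lra.
  - replace (node n i + 1 / 2) with (node n (i + 1) - 1 / 2) by lra.
    eapply is_RInt_ext; [|apply rec_cell_left_half; apply Hv].
    intros x. rewrite Rmin_left, Rmax_right by lra. intros Hx.
    symmetry. apply u_rec_cell. lra.
Qed.

(** * Fronts and the motion of their ends *)

Definition front (alpha : R) (l r : Z) (v : Z -> R) : Prop :=
  (l < r)%Z /\
  (forall j : Z, (j <= l)%Z -> v j = 0) /\
  (forall j : Z, (r <= j)%Z -> v j = 1) /\
  0 < jump v (l + 1) /\ 0 < jump v r /\
  (forall j : Z, (l + 1 < j < r)%Z -> alpha < jump v j).

(** [evolve] gives the cell midway between [i] and [i + 1] the index [i]. So keeping [l] is a move
    inwards by half a cell and [l - 1] a move outwards; on the right, [r] is outwards and [r - 1]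
    inwards. Ties go inwards. *)
Definition next_left (v : Z -> R) (l : Z) : Z :=
  if Rlt_dec (jump v (l + 2)) (jump v (l + 1)) then (l - 1)%Z else l.

Definition next_right (v : Z -> R) (r : Z) : Z :=
  if Rlt_dec (jump v (r - 1)) (jump v r) then r else (r - 1)%Z.

Ltac rmin := repeat
  match goal with
  | |- context [Rmin ?a ?b] => unfold Rmin at 1; destruct (Rle_dec a b)
  | H : context [Rmin ?a ?b] |- _ => unfold Rmin at 1 in H; destruct (Rle_dec a b)
  end.

Lemma front_jump_outside {alpha : R} {l r : Z} {v : Z -> R} (j : Z) :
  front alpha l r v -> (j <= l \/ r < j)%Z -> jump v j = 0.
Proof.
  intros (_ & H0 & H1 & _) [Hj|Hj]; unfold jump.
  - rewrite !H0 by lia. lra.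
  - rewrite !H1 by lia. lra.
Qed.

Lemma front_jump_pos {alpha : R} {l r : Z} {v : Z -> R} (j : Z) :
  0 < alpha -> front alpha l r v -> (l < j <= r)%Z -> 0 < jump v j.
Proof.
  intros Ha (_ & _ & _ & Hl & Hr & Hi) Hj.
  destruct (Z.eq_dec j (l + 1)) as [->|]; [easy|].
  destruct (Z.eq_dec j r) as [->|]; [easy|].
  specialize (Hi j ltac:(lia)). lra.
Qed.

Lemma front_mono {alpha : R} {l r : Z} {v : Z -> R} (j : Z) :
  0 < alpha -> front alpha l r v -> 0 <= jump v j.
Proof.
  intros Ha H. destruct (Z_le_gt_dec j l); [rewrite (front_jump_outside j H); lia || lra|].
  destruct (Z_le_gt_dec j r); [|rewrite (front_jump_outside j H); lia || lra].
  apply Rlt_le, (front_jump_pos j Ha H). lia.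
Qed.

(** The subtracted minima satisfy [m_(j-1) <= a_j] and [m_(j+1) <= a_(j+1)], which leaves at least
    [m_j]. *)
Lemma jump_evolve_ge_Rmin (v : Z -> R) (j : Z) : Rmin (jump v j) (jump v (j + 1)) <= jump (evolve v) j.
Proof.
  rewrite (jump_evolve v (j - 1) j (j + 1) (j + 2)) by lia.
  pose proof (Rmin_r (jump v (j - 1)) (jump v j)).
  pose proof (Rmin_l (jump v (j + 1)) (jump v (j + 2))).
  rmin; lra.
Qed.

(** Jumps outside the front vanish, so the new jump at [l] is [(a_(l+1) - m_(l+1)) / 2], positive
    exactly when the first jump exceeds the second; the right end is symmetric. Inner jumps stay
    above [alpha] by [jump_evolve_ge_Rmin]. *)
Lemma front_evolve {alpha : R} {l r : Z} {v : Z -> R} : 0 < alpha -> front alpha l r v ->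
  front alpha (next_left v l) (next_right v r) (evolve v).
Proof.
  intros Ha H.
  pose proof (front_jump_outside (l - 1) H ltac:(lia)) as Dl1.
  pose proof (front_jump_outside l H ltac:(lia)) as Dl.
  pose proof (front_jump_outside (r + 1) H ltac:(lia)) as Dr1.
  pose proof (front_jump_outside (r + 2) H ltac:(lia)) as Dr2.
  pose proof (front_mono (l + 2) Ha H) as Ml.
  pose proof (front_mono (r - 1) Ha H) as Mr.
  pose proof (fun j => front_jump_pos j Ha H) as Hp.
  pose proof (fun j => front_jump_outside j H) as Ho.
  destruct H as (Hlr & H0 & H1 & Hl & Hr & Hi).
  pose proof (jump_evolve v (l - 1) l (l + 1) (l + 2) ltac:(lia) ltac:(lia) ltac:(lia)) as El.
  pose proof (jump_evolve v (r - 1) r (r + 1) (r + 2) ltac:(lia) ltac:(lia) ltac:(lia)) as Er.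
  rewrite Dl, Dl1, (Rmin_left 0 0), (Rmin_left 0 (jump v (l + 1))) in El by lra.
  rewrite Dr1, Dr2, (Rmin_left 0 0), (Rmin_right (jump v r) 0) in Er by lra.
  assert (G0 : forall j, (j < l)%Z -> evolve v j = 0).
  { intros j Hj. rewrite (evolve_eq v j (j + 1) (j + 2)) by lia.
    rewrite !H0, (Ho j), (Ho (j + 1)%Z) by lia.
    destruct (Z.eq_dec (j + 2) (l + 1)) as [->|].
    - rmin; lra.
    - rewrite (Ho (j + 2)%Z) by lia. rmin; lra. }
  assert (G1 : forall j, (r <= j)%Z -> evolve v j = 1).
  { intros j Hj. rewrite (evolve_eq v j (j + 1) (j + 2)) by lia.
    rewrite !H1, (Ho (j + 2)%Z), (Ho (j + 1)%Z) by lia.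
    destruct (Z.eq_dec j r) as [->|].
    - rmin; lra.
    - rewrite (Ho j) by lia. rmin; lra. }
  assert (Gl : evolve v l = jump (evolve v) l).
  { unfold jump. rewrite (G0 (l - 1)%Z) by lia. lra. }
  assert (Gr : evolve v (r - 1)%Z = 1 - jump (evolve v) r).
  { unfold jump. rewrite (G1 r) by lia. lra. }
  assert (Gp : forall j, (l < j < r)%Z -> 0 < jump (evolve v) j).
  { intros j Hj. eapply Rlt_le_trans; [|apply jump_evolve_ge_Rmin].
    apply Rmin_glb_lt; apply Hp; lia. }
  assert (Gi : forall j, (l + 1 < j)%Z -> (j + 1 < r)%Z -> alpha < jump (evolve v) j).
  { intros j Hj1 Hj2. eapply Rlt_le_trans; [|apply jump_evolve_ge_Rmin].
    apply Rmin_glb_lt; apply Hi; lia. }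
  (* After an outward move the jump at [l + 1] is an inner one and must exceed [alpha]. The old
     first jump, only known to be positive, exceeds [alpha] here because it exceeds the inner jump
     at [l + 2]. *)
  assert (Fl : (l + 2 < r)%Z -> jump v (l + 2) < jump v (l + 1) -> alpha < jump (evolve v) (l + 1)).
  { intros Hlr2 Hlt. eapply Rlt_le_trans; [|apply jump_evolve_ge_Rmin].
    specialize (Hi (l + 2)%Z ltac:(lia)).
    replace (l + 1 + 1)%Z with (l + 2)%Z by lia. apply Rmin_glb_lt; lra. }
  assert (Fr : (l + 2 < r)%Z -> jump v (r - 1) < jump v r -> alpha < jump (evolve v) (r - 1)).
  { intros Hlr2 Hlt. eapply Rlt_le_trans; [|apply jump_evolve_ge_Rmin].
    specialize (Hi (r - 1)%Z ltac:(lia)).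
    replace (r - 1 + 1)%Z with r by lia. apply Rmin_glb_lt; lra. }
  (* A single jump moves outwards at both ends, a pair of jumps never does; this discards impossible
     widths in the four cases below. *)
  assert (W1 : r = (l + 1)%Z -> jump v (l + 2) < jump v (l + 1) /\ jump v (r - 1) < jump v r).
  { intros ->. replace (l + 1 - 1)%Z with l by lia.
    rewrite (Ho (l + 2)%Z), (Ho l) by lia. lra. }
  assert (W2 : r = (l + 2)%Z -> jump v (l + 2) < jump v (l + 1) -> ~ jump v (r - 1) < jump v r).
  { intros ->. replace (l + 2 - 1)%Z with (l + 1)%Z by lia. lra. }
  unfold front, next_left, next_right.
  destruct (Rlt_dec (jump v (l + 2)) (jump v (l + 1))) as [cl|cl];
  destruct (Rlt_dec (jump v (r - 1)) (jump v r)) as [cr|cr].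
  - assert (N2 : r <> (l + 2)%Z) by tauto.
    repeat split.
    + lia.
    + intros j Hj. apply G0. lia.
    + exact G1.
    + replace (l - 1 + 1)%Z with l by lia. rewrite El. rmin; lra.
    + rewrite Er. rmin; lra.
    + intros j Hj. destruct (Z.eq_dec j (l + 1)) as [->|]; [apply Fl; auto; lia|].
      destruct (Z.eq_dec j (r - 1)) as [->|]; [apply Fr; auto; lia|]. apply Gi; lia.
  - assert (N1 : r <> (l + 1)%Z) by tauto.
    repeat split.
    + lia.
    + intros j Hj. apply G0. lia.
    + intros j Hj. destruct (Z.eq_dec j (r - 1)) as [->|]; [|apply G1; lia].
      rewrite Gr, Er. rmin; lra.
    + replace (l - 1 + 1)%Z with l by lia. rewrite El. rmin; lra.
    + apply Gp. lia.
    + intros j Hj. destruct (Z.eq_dec j (l + 1)) as [->|]; [apply Fl; auto; lia|].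
      apply Gi; lia.
  - assert (N1 : r <> (l + 1)%Z) by tauto.
    repeat split.
    + lia.
    + intros j Hj. destruct (Z.eq_dec j l) as [->|]; [|apply G0; lia].
      rewrite Gl, El. rmin; lra.
    + exact G1.
    + apply Gp. lia.
    + rewrite Er. rmin; lra.
    + intros j Hj. destruct (Z.eq_dec j (r - 1)) as [->|]; [apply Fr; auto; lia|].
      apply Gi; lia.
  - assert (N1 : r <> (l + 1)%Z) by tauto.
    repeat split.
    + lia.
    + intros j Hj. destruct (Z.eq_dec j l) as [->|]; [|apply G0; lia].
      rewrite Gl, El. rmin; lra.
    + intros j Hj. destruct (Z.eq_dec j (r - 1)) as [->|]; [|apply G1; lia].
      rewrite Gr, Er. rmin; lra.
    + apply Gp. lia.
    + apply Gp. lia.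
    + intros j Hj. apply Gi; lia.
Qed.

(** Let [x > y] be the first two jumps and [m] the minimum of the second and third. An outward move
    makes the first two jumps [(x - y) / 2] and [(x + 3 y - m) / 2]. Since [m <= y], the first does
    not exceed the second, and the next move is inwards. *)
Lemma next_left_twice_ge {alpha : R} {l r : Z} {v : Z -> R} : 0 < alpha ->
  front alpha l r v -> (l - 1 <= next_left (evolve v) (next_left v l))%Z.
Proof.
  intros Ha H. unfold next_left at 2. destruct (Rlt_dec _ _) as [c|c].
  - unfold next_left. replace (l - 1 + 2)%Z with (l + 1)%Z by lia.
    replace (l - 1 + 1)%Z with l by lia.
    destruct (Rlt_dec _ _) as [c'|c']; [exfalso|lia].
    rewrite (jump_evolve v (l - 1) l (l + 1) (l + 2)) in c' by lia.
    rewrite (jump_evolve v l (l + 1) (l + 2) (l + 3)) in c' by lia.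
    rewrite (front_jump_outside (l - 1) H), (front_jump_outside l H) in c' by lia.
    pose proof (front_mono (l + 2) Ha H). pose proof (front_mono (l + 1) Ha H).
    pose proof (Rmin_l (jump v (l + 2)) (jump v (l + 3))).
    rewrite (Rmin_left 0 0), (Rmin_left 0 (jump v (l + 1))), (Rmin_right (jump v (l + 1))) in c'
      by lra. lra.
  - unfold next_left. destruct (Rlt_dec _ _); lia.
Qed.

Lemma next_right_twice_le {alpha : R} {l r : Z} {v : Z -> R} : 0 < alpha ->
  front alpha l r v -> (next_right (evolve v) (next_right v r) <= r - 1)%Z.
Proof.
  intros Ha H. unfold next_right at 2. destruct (Rlt_dec _ _) as [c|c].
  - unfold next_right.
    destruct (Rlt_dec _ _) as [c'|c']; [exfalso|lia].
    rewrite (jump_evolve v (r - 1) r (r + 1) (r + 2)) in c' by lia.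
    rewrite (jump_evolve v (r - 2) (r - 1) r (r + 1)) in c' by lia.
    rewrite (front_jump_outside (r + 1) H), (front_jump_outside (r + 2) H) in c' by lia.
    pose proof (front_mono (r - 1) Ha H). pose proof (front_mono r Ha H).
    pose proof (Rmin_r (jump v (r - 2)) (jump v (r - 1))).
    rewrite (Rmin_left 0 0), (Rmin_right (jump v r) 0), (Rmin_left (jump v (r - 1))) in c'
      by lra. lra.
  - unfold next_right. destruct (Rlt_dec _ _); lia.
Qed.

Lemma next_left_bounds (v : Z -> R) (l : Z) : (l - 1 <= next_left v l <= l)%Z.
Proof. unfold next_left. destruct (Rlt_dec _ _); lia. Qed.

Lemma next_right_bounds (v : Z -> R) (r : Z) : (r - 1 <= next_right v r <= r)%Z.
Proof. unfold next_right. destruct (Rlt_dec _ _); lia. Qed.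

(** With [x], [y] the first two jumps and [m] as in the bound, let [p = (x - y) / 2],
    [q = (x + 3 y - m) / 2] and [s] be the first three jumps after one step. The next jump at [l] is
    [(3 p + q - min(q, s)) / 2]. Both [q] and [s] are at least [m], which gives [x - 3/4 m]. *)
Lemma outward_left_jump_decrease {alpha : R} {l r : Z} {v : Z -> R} : 0 < alpha ->
  front alpha l r v -> jump v (l + 2) < jump v (l + 1) ->
  jump (evolve (evolve v)) l <= jump v (l + 1) - 3 / 4 * Rmin (jump v (l + 2)) (jump v (l + 3)).
Proof.
  intros Ha H c.
  pose proof (front_mono (l + 2) Ha H). pose proof (front_mono (l + 1) Ha H).
  pose proof (front_mono (l + 3) Ha H).
  pose proof (front_jump_outside (l - 2) H ltac:(lia)) as E2.
  pose proof (front_jump_outside (l - 1) H ltac:(lia)) as E1.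
  pose proof (front_jump_outside l H ltac:(lia)) as E0.
  pose proof (jump_evolve_ge_Rmin v (l + 1)) as B1. pose proof (jump_evolve_ge_Rmin v (l + 2)) as B2.
  replace (l + 1 + 1)%Z with (l + 2)%Z in B1 by lia.
  replace (l + 2 + 1)%Z with (l + 3)%Z in B2 by lia.
  set (m := Rmin (jump v (l + 2)) (jump v (l + 3))) in *.
  pose proof (Rmin_l (jump v (l + 2)) (jump v (l + 3))) as Hm. fold m in Hm.
  rewrite Rmin_right in B1 by lra.
  pose proof (Rmin_glb (jump (evolve v) (l + 1)) (jump (evolve v) (l + 2)) m ltac:(lra) B2).
  rewrite (jump_evolve (evolve v) (l - 1) l (l + 1) (l + 2)) by lia.
  assert (jump (evolve v) (l - 1) = 0) as ->.
  { rewrite (jump_evolve v (l - 2) (l - 1) l (l + 1)) by lia. rewrite E2, E1, E0.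
    rewrite (Rmin_left 0 0), (Rmin_left 0 (jump v (l + 1))) by lra. lra. }
  pose proof (jump_evolve v (l - 1) l (l + 1) (l + 2) ltac:(lia) ltac:(lia) ltac:(lia)) as E3.
  pose proof (jump_evolve v l (l + 1) (l + 2) (l + 3) ltac:(lia) ltac:(lia) ltac:(lia)) as E4.
  rewrite E1, E0, (Rmin_left 0 0), (Rmin_left 0 (jump v (l + 1))),
    (Rmin_right (jump v (l + 1))) in E3 by lra.
  rewrite E0, (Rmin_left 0 (jump v (l + 1))),
    (Rmin_right (jump v (l + 1))) in E4 by lra. fold m in E4.
  rewrite (Rmin_left 0 (jump (evolve v) l)), (Rmin_left (jump (evolve v) l)) by lra. lra.
Qed.

(** Three jumps [x > y >= z]: the right end moves inwards twice while the left
    end moves outwards and back. *)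
Lemma three_jumps_shrink {alpha : R} {l : Z} {v : Z -> R} : 0 < alpha ->
  front alpha l (l + 3) v -> jump v (l + 2) < jump v (l + 1) -> jump v (l + 3) <= jump v (l + 2) ->
  next_right (evolve v) (next_right v (l + 3)) = (l + 1)%Z.
Proof.
  intros Ha H c d. unfold next_right at 2.
  replace (l + 3 - 1)%Z with (l + 2)%Z by lia.
  destruct (Rlt_dec _ _) as [c'|_]; [lra|]. unfold next_right.
  replace (l + 2 - 1)%Z with (l + 1)%Z by lia.
  destruct (Rlt_dec _ _) as [c'|_]; [exfalso|lia].
  (* For jumps [x > y >= z], the new jumps at [l + 1] and [l + 2] are [(x + 3 y - z) / 2] and
     [3 z / 2], so the second cannot be larger. *)
  pose proof (front_jump_pos (l + 3) Ha H ltac:(lia)).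
  rewrite (jump_evolve v l (l + 1) (l + 2) (l + 3)) in c' by lia.
  rewrite (jump_evolve v (l + 1) (l + 2) (l + 3) (l + 4)) in c' by lia.
  rewrite (front_jump_outside l H), (front_jump_outside (l + 4) H) in c' by lia.
  rewrite (Rmin_right (jump v (l + 1))), (Rmin_right (jump v (l + 2))),
    (Rmin_left 0 (jump v (l + 1))), (Rmin_right (jump v (l + 3)) 0) in c' by lra.
  lra.
Qed.

(** * Fronts of width at most two *)

Definition narrow (alpha : R) (v : Z -> R) : Prop :=
  exists l r : Z, front alpha l r v /\ (r - l <= 2)%Z.

Lemma next_width_two {alpha : R} {l : Z} {v : Z -> R} : 0 < alpha ->
  front alpha l (l + 2) v -> (next_right v (l + 2) - next_left v l <= 2)%Z.
Proof.
  intros Ha H. unfold next_right, next_left.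
  replace (l + 2 - 1)%Z with (l + 1)%Z by lia.
  destruct (Rlt_dec _ _); destruct (Rlt_dec _ _); lra || lia.
Qed.

Lemma narrow_evolve {alpha : R} {v : Z -> R} : 0 < alpha -> narrow alpha v -> narrow alpha (evolve v).
Proof.
  intros Ha (l & r & H & Hw). exists (next_left v l), (next_right v r).
  split; [now apply front_evolve|].
  pose proof (next_left_bounds v l). pose proof (next_right_bounds v r).
  destruct (Z.eq_dec r (l + 2)) as [->|]; [exact (next_width_two Ha H)|lia].
Qed.

Lemma narrow_iter {alpha : R} {v : Z -> R} (n : nat) : 0 < alpha ->
  narrow alpha v -> narrow alpha (Nat.iter n evolve v).
Proof. intros Ha H. induction n as [|n IH]; [easy|]. now apply narrow_evolve. Qed.

(** Two half-cell moves account for the index shift by 1. The bounds on the ends after two steps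
    restore the values 0 and 1 outside the front. *)
Lemma evolve_twice_narrow {alpha : R} {v : Z -> R} (j : Z) : 0 < alpha -> narrow alpha v ->
  evolve (evolve v) (j - 1)%Z = v j.
Proof.
  intros Ha (l & r & H & Hw).
  pose proof (front_evolve Ha H) as H1. pose proof (front_evolve Ha H1) as H2.
  pose proof (next_left_twice_ge Ha H) as Bl. pose proof (next_right_twice_le Ha H) as Br.
  pose proof (front_jump_outside l H ltac:(lia)) as Dl.
  pose proof (front_jump_outside (l - 1) H ltac:(lia)) as Dl1.
  pose proof (fun j => front_jump_outside j H) as Ho. pose proof H as Hf.
  destruct H2 as (_ & Z0 & Z1 & _). destruct H as (Hlr & H0 & Hr & Hp & _).
  destruct (Z_le_gt_dec j l); [rewrite Z0, H0 by lia; easy|].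
  destruct (Z_le_gt_dec r j); [rewrite Z1, Hr by lia; easy|].
  (* Only the middle value of a front with two jumps remains; it is computed explicitly from jumps
     [a], [b] with [a + b = 1]. *)
  assert (j = (l + 1)%Z) as -> by lia. assert (r = (l + 2)%Z) as -> by lia.
  clear Z0 Z1. replace (l + 1 - 1)%Z with l by lia.
  rewrite (evolve_eq (evolve v) l (l + 1) (l + 2)) by lia.
  rewrite (jump_evolve v (l - 1) l (l + 1) (l + 2)) by lia.
  rewrite (jump_evolve v l (l + 1) (l + 2) (l + 3)) by lia.
  rewrite (jump_evolve v (l + 1) (l + 2) (l + 3) (l + 4)) by lia.
  rewrite (evolve_eq v l (l + 1) (l + 2)), (evolve_eq v (l + 1) (l + 2) (l + 3)) by lia.
  rewrite Dl, Dl1, (Ho (l + 3)%Z), (Ho (l + 4)%Z), (H0 l), (Hr (l + 2)%Z) by lia.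
  pose proof (front_jump_pos (l + 1) Ha Hf ltac:(lia)) as P1.
  pose proof (front_jump_pos (l + 2) Ha Hf ltac:(lia)) as P2.
  assert (Hsum : jump v (l + 1) + jump v (l + 2) = 1).
  { rewrite (jump_eq v l (l + 1)), (jump_eq v (l + 1) (l + 2)) by lia.
    rewrite (H0 l), (Hr (l + 2)%Z) by lia. lra. }
  assert (v (l + 1)%Z = jump v (l + 1)) as ->.
  { rewrite (jump_eq v l (l + 1)), (H0 l) by lia. lra. }
  set (a := jump v (l + 1)) in *. set (b := jump v (l + 2)) in *.
  rewrite (Rmin_left 0 0), (Rmin_left 0 a), (Rmin_right b 0) by lra.
  destruct (Rle_dec a b).
  - rewrite (Rmin_left a b) by lra. rewrite Rmin_left, Rmin_right by lra. lra.
  - rewrite (Rmin_right a b) by lra. rewrite Rmin_left, Rmin_right by lra. lra.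
Qed.

(** * Uniform bound on the time needed to become narrow *)

Definition width_sum (v : Z -> R) (l r : Z) : Z :=
  (r - l) + (next_right v r - next_left v l).

Definition narrows_within (alpha : R) (p : nat) (v : Z -> R) : Prop :=
  exists q : nat, (q <= p)%nat /\ narrow alpha (Nat.iter q evolve v).

Lemma narrows_within_iter {alpha : R} {p : nat} {v : Z -> R} (k : nat) :
  narrows_within alpha p (Nat.iter k evolve v) -> narrows_within alpha (k + p) v.
Proof.
  intros (q & Hq & H). exists (q + k)%nat. split; [lia|]. now rewrite Nat.iter_add.
Qed.

Lemma narrows_within_le {alpha : R} {p q : nat} {v : Z -> R} : (p <= q)%nat ->
  narrows_within alpha p v -> narrows_within alpha q v.
Proof. intros Hpq (k & Hk & H). exists k. split; [lia|easy]. Qed.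

Lemma narrows_within_of_width_two {alpha : R} {l r : Z} {v : Z -> R} (p : nat) :
  front alpha l r v -> (r - l <= 2)%Z -> narrows_within alpha p v.
Proof. intros H Hw. exists 0%nat. split; [lia|]. exists l, r. auto. Qed.

(** The width may go up and down by one, but its sum over two consecutive times never increases, so
    it serves for the induction. The bound [p] is uniform in the data. *)
Definition narrows_from_width_sum (alpha : R) (s p : nat) : Prop :=
  forall v l r, front alpha l r v -> (width_sum v l r <= Z.of_nat s)%Z ->
    narrows_within alpha p v.

(** When the left end moves outwards at time 0, it moves inwards at time 1; if
    it moves inwards again at time 2 the width sum has dropped, and otherwise the
    first jump has lost at least [3 / 4 * alpha]. *)
Lemma narrows_outward {alpha : R} {s p : nat} (k : nat) : 0 < alpha ->
  narrows_from_width_sum alpha s p ->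
  forall v l r, front alpha l r v -> (width_sum v l r <= Z.of_nat (S s))%Z ->
    jump v (l + 2) < jump v (l + 1) -> jump v (l + 1) <= INR k * (3 / 4 * alpha) ->
    narrows_within alpha (2 * k + p) v.
Proof.
  intros Ha Hp. induction k as [|k IH]; intros v l r H Hs c Hk.
  { pose proof (front_jump_pos (l + 1) Ha H) as P. destruct H as [Hlr _].
    specialize (P ltac:(lia)). cbn in Hk. lra. }
  destruct (Z_le_gt_dec (r - l) 2) as [Hw|Hw].
  { now apply (narrows_within_of_width_two _ H). }
  pose proof (front_evolve Ha H) as H1. pose proof (front_evolve Ha H1) as H2.
  pose proof (next_right_twice_le Ha H) as Br2. pose proof (next_right_twice_le Ha H1) as Br3.
  pose proof (next_left_twice_ge Ha H) as Bl2.
  pose proof (outward_left_jump_decrease Ha H c) as Hdec.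
  assert (E1 : next_left v l = (l - 1)%Z).
  { unfold next_left. now destruct (Rlt_dec _ _). }
  rewrite E1 in *.
  assert (E2 : next_left (evolve v) (l - 1) = (l - 1)%Z).
  { pose proof (next_left_bounds (evolve v) (l - 1)). lia. }
  rewrite E2 in *.
  set (r1 := next_right v r) in *. set (r2 := next_right (evolve v) r1) in *.
  set (w := evolve (evolve v)) in *. unfold width_sum in Hs. rewrite E1 in Hs. fold r1 in Hs.
  replace (2 * S k + p)%nat with (2 + (2 * k + p))%nat by lia.
  apply (narrows_within_iter 2). change (Nat.iter 2 evolve v) with w.
  pose proof (next_left_bounds w (l - 1)) as Bl3.
  destruct (Z.eq_dec (next_left w (l - 1)) (l - 1)) as [El3|Nl3].
  { apply (narrows_within_le (p := p)); [lia|]. apply (Hp w (l - 1)%Z r2 H2).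
    unfold width_sum. lia. }
  assert (E3 : next_left w (l - 1) = (l - 1 - 1)%Z) by lia.
  destruct (Rlt_dec alpha (Rmin (jump v (l + 2)) (jump v (l + 3)))) as [Hm|Hm].
  - apply (IH w (l - 1)%Z r2 H2).
    + unfold width_sum. lia.
    + unfold next_left in E3. destruct (Rlt_dec _ _); [easy|lia].
    + replace (l - 1 + 1)%Z with l by lia. rewrite S_INR in Hk. lra.
  (* The jump at [l + 2] is inner and exceeds [alpha], so the one at [l + 3] does not. Hence it is
     the last jump and smaller than its neighbour: the case of [three_jumps_shrink]. *)
  - apply (narrows_within_of_width_two _ H2).
    assert (Hi : forall j, (l + 1 < j < r)%Z -> alpha < jump v j) by apply H.
    pose proof (Hi (l + 2)%Z ltac:(lia)) as Hi2.
    assert (r = (l + 3)%Z) as ->.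
    { destruct (Z.eq_dec r (l + 3)); [easy|]. exfalso. apply Hm.
      apply Rmin_glb_lt; apply Hi; lia. }
    unfold r2, r1. rewrite (three_jumps_shrink Ha H c); [lia|].
    apply Rnot_lt_le. intros Hlt. apply Hm. apply Rmin_glb_lt; lra.
Qed.

Lemma front_first_jump_le_1 {alpha : R} {l r : Z} {v : Z -> R} : 0 < alpha ->
  front alpha l r v -> jump v (l + 1) <= 1.
Proof.
  intros Ha H.
  assert (Hle : forall n : nat, v (l + 1)%Z <= v (l + 1 + Z.of_nat n)%Z).
  { induction n as [|n IH]; [rewrite Z.add_0_r; lra|].
    pose proof (front_mono (l + 1 + Z.of_nat (S n)) Ha H) as M.
    rewrite (jump_eq v (l + 1 + Z.of_nat n)) in M by lia. lra. }
  destruct H as (Hlr & H0 & H1 & _). specialize (Hle (Z.to_nat (r - l))).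
  rewrite (H1 (l + 1 + _)%Z) in Hle by lia.
  rewrite (jump_eq v l (l + 1)), (H0 l) by lia. lra.
Qed.

Lemma narrows_uniformly (alpha : R) (s : nat) : 0 < alpha ->
  exists p, narrows_from_width_sum alpha s p.
Proof.
  intros Ha. induction s as [|s [p Hp]].
  (* Both widths are at least 1, so their sum is not 0. *)
  { exists 0%nat. intros v l r H Hs. exfalso. pose proof (front_evolve Ha H) as [H1 _].
    destruct H as [H _]. unfold width_sum in Hs. lia. }
  (* After [k] losses of [3/4 alpha] nothing would be left of a first jump, which is at most 1. *)
  destruct (INR_archimed (3 / 4 * alpha) 1) as [k Hk]; [lra|].
  exists (1 + (2 * k + p))%nat. intros v l r H Hs.
  pose proof (front_evolve Ha H) as H1.
  destruct (Rlt_dec (jump v (l + 2)) (jump v (l + 1))) as [c|c].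
  { apply (narrows_within_le (p := (2 * k + p)%nat)); [lia|].
    apply (narrows_outward k Ha Hp v l r H Hs c).
    pose proof (front_first_jump_le_1 Ha H). lra. }
  (* The left end has moved inwards. At the next step it either moves outwards, so that
     [narrows_outward] applies, or moves inwards again and the width sum drops. *)
  apply (narrows_within_iter 1). change (Nat.iter 1 evolve v) with (evolve v).
  assert (E1 : next_left v l = l).
  { unfold next_left. now destruct (Rlt_dec _ _). }
  rewrite E1 in H1. unfold width_sum in Hs. rewrite E1 in Hs.
  pose proof (next_right_twice_le Ha H) as Br2.
  destruct (Rlt_dec (jump (evolve v) (l + 2)) (jump (evolve v) (l + 1))) as [c1|c1].
  - apply (narrows_outward k Ha Hp _ _ _ H1).
    + unfold width_sum, next_left. destruct (Rlt_dec _ _); [lia|easy].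
    + exact c1.
    + pose proof (front_first_jump_le_1 Ha H1). lra.
  - apply (narrows_within_le (p := p)); [lia|]. apply (Hp _ _ _ H1).
    unfold width_sum, next_left. destruct (Rlt_dec _ _); [easy|lia].
Qed.

(** * Return to the alternately shifted grids *)

Lemma jump_shift {v w : Z -> R} (h : Z) : (forall i, w i = v (i - h)%Z) ->
  forall j, jump w j = jump v (j - h).
Proof.
  intros E j. unfold jump. rewrite !E. now replace (j - 1 - h)%Z with (j - h - 1)%Z by lia.
Qed.

Lemma evolve_shift {v w : Z -> R} (h : Z) : (forall i, w i = v (i - h)%Z) ->
  forall j, evolve w j = evolve v (j - h).
Proof.
  intros E j. unfold evolve. rewrite !(jump_shift h E), !E.
  replace (j + 1 - h)%Z with (j - h + 1)%Z by lia.
  now replace (j + 2 - h)%Z with (j - h + 2)%Z by lia.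
Qed.

(** The indexing of [evolve] agrees with [node] on steps from even to odd times and lags by 1 on
    steps from odd to even times, which adds up to [n / 2]. All iterates are fronts, hence monotone
    as [step_evolve] requires. *)
Lemma solution_evolve (alpha : R) (l r : Z) (u : Z -> R) (n : nat) : 0 < alpha ->
  front alpha l r u ->
  forall i : Z, solution u n i = Nat.iter n evolve u (i - Z.of_nat (n / 2))%Z.
Proof.
  intros Ha H.
  assert (Hf : forall m, exists l r, front alpha l r (Nat.iter m evolve u)).
  { induction m as [|m (l' & r' & IH)]; [now exists l, r|].
    eexists _, _. exact (front_evolve Ha IH). }
  induction n as [|n IH]; intros i; [cbn; f_equal; lia|].
  destruct (Hf n) as (l' & r' & Hn).
  cbn [solution]. rewrite step_evolve
    by (intros j; rewrite (jump_shift _ IH); exact (front_mono _ Ha Hn)).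
  assert (Hh : (S n / 2 = n / 2 + if Nat.even n then 0 else 1)%nat).
  { destruct (Nat.even n) eqn:E.
    - apply Nat.even_spec in E as [q ->].
      replace (S (2 * q))%nat with (1 + q * 2)%nat by lia.
      rewrite (Nat.mul_comm 2 q), Nat.div_add, Nat.div_mul by lia. cbn. lia.
    - assert (O : Nat.odd n = true) by now rewrite <- Nat.negb_even, E.
      apply Nat.odd_spec in O as [q ->].
      replace (S (2 * q + 1))%nat with ((q + 1) * 2)%nat by lia.
      replace (2 * q + 1)%nat with (1 + q * 2)%nat by lia.
      rewrite Nat.div_add, Nat.div_mul by lia. cbn. lia. }
  rewrite (evolve_shift _ IH), Hh. change (Nat.iter (S n) evolve u) with (evolve (Nat.iter n evolve u)).
  f_equal. destruct (Nat.even n); lia.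
Qed.

Lemma front_H_class (alpha : R) (M : Z) (v : Z -> R) : (0 < M)%Z ->
  (H_class alpha M v <-> exists l, front alpha l (l + M) v).
Proof.
  intros HM. split; intros [l H]; exists l.
  - destruct H as (H0 & H1 & Hl & Hr & Hi). repeat split; auto; try lia.
    + rewrite (jump_eq v l (l + 1)) by lia. lra.
    + intros j Hj. specialize (Hi (j - 1)%Z ltac:(lia)).
      rewrite (jump_eq v (j - 1) j) by lia. now replace (j - 1 + 1)%Z with j in Hi by lia.
  - destruct H as (Hlr & H0 & H1 & Hl & Hr & Hi). repeat split; auto.
    + rewrite (jump_eq v l (l + 1)) in Hl by lia. lra.
    + intros j Hj. rewrite <- (jump_eq v j (j + 1)) by lia. apply Hi. lia.
Qed.

Lemma front_shift {alpha : R} {l r : Z} {v w : Z -> R} (h : Z) :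
  (forall i, w i = v (i - h)%Z) -> front alpha l r v -> front alpha (l + h) (r + h) w.
Proof.
  intros E (Hlr & H0 & H1 & Hl & Hr & Hi).
  pose proof (jump_shift h E) as ED.
  repeat split.
  - lia.
  - intros j Hj. rewrite E. apply H0. lia.
  - intros j Hj. rewrite E. apply H1. lia.
  - rewrite ED. now replace (l + h + 1 - h)%Z with (l + 1)%Z by lia.
  - rewrite ED. now replace (r + h - h)%Z with r by lia.
  - intros j Hj. rewrite ED. apply Hi. lia.
Qed.

Theorem theorem11 :
  forall (alpha : R) (M : Z), alpha > 0 -> (M > 0)%Z ->
  exists p : nat,
    forall u0 : Z -> R, H_class alpha M u0 ->
      (forall n : nat, (p <= n)%nat ->
         H_class alpha 2 (solution u0 n) \/ H_class alpha 1 (solution u0 n)) /\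
      (forall n : nat, (p <= n)%nat ->
         forall i : Z, solution u0 (n + 2)%nat i = solution u0 n i).
Proof.
  intros alpha M Ha HM.
  (* The initial width is [M] and the next one at most [M + 1]. *)
  destruct (narrows_uniformly alpha (Z.to_nat (2 * M + 1)) Ha) as [p Hp].
  exists p. intros u H. apply front_H_class in H as [l H]; [|lia].
  assert (Hn : forall n, (p <= n)%nat -> narrow alpha (Nat.iter n evolve u)).
  { intros n Hn. destruct (Hp u l (l + M)%Z H) as (q & Hq & Hnar).
    - unfold width_sum. pose proof (next_left_bounds u l).
      pose proof (next_right_bounds u (l + M)). lia.
    - replace n with ((n - q) + q)%nat by lia. rewrite Nat.iter_add.
      now apply narrow_iter. }
  pose proof (fun n => solution_evolve alpha _ _ u n Ha H) as Hsol.
  split; intros n Hpn; pose proof (Hn n Hpn) as Hnar.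
  - destruct Hnar as (l' & r' & Hf & Hw).
    pose proof (front_shift (Z.of_nat (n / 2)) (Hsol n) Hf) as Hf'.
    pose proof Hf as [Hlr _].
    assert (r' = l' + 2 \/ r' = l' + 1)%Z as [->| ->] by lia; [left|right];
      apply front_H_class; try lia; exists (l' + Z.of_nat (n / 2))%Z;
      [replace (l' + _ + 2)%Z with (l' + 2 + Z.of_nat (n / 2))%Z by lia
      |replace (l' + _ + 1)%Z with (l' + 1 + Z.of_nat (n / 2))%Z by lia]; exact Hf'.
  - intros i. rewrite !Hsol.
    (* Two more time steps increase the shift by 1, matching the [j - 1] in
       [evolve_twice_narrow]. *)
    replace ((n + 2) / 2)%nat with (S (n / 2))
      by (replace (n + 2)%nat with (n + 1 * 2)%nat by lia; rewrite Nat.div_add; lia).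
    rewrite (Nat.add_comm n 2).
    rewrite <- (evolve_twice_narrow (i - Z.of_nat (n / 2)) Ha Hnar).
    cbn [Nat.add Nat.iter nat_rect].
    f_equal. lia.
Qed.
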